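(* Let $M\ge 4N-2$. Then a generic $N$-dimensional complex subspace $W\subset\mathbb C^M$ has the property: if $v=(v_1,\dots,v_M)$ and $w=(w_1,\dots,w_M)$ are vectors in $W$ with $|v_i|=|w_i|$ for all $i$, then $v=\lambda w$ for some $\lambda\in\mathbb C$ with $|\lambda|=1$.
   Context: ''Generic'' means: for all $W$ in an open dense subset of the complex Grassmannian $Gr(N,M)^{\mathbb C}$ of $N$-dimensional complex subspaces of $\mathbb C^M$. *)

(* Defs.v *)
From mathcomp Require Import all_boot all_order all_algebra.
From mathcomp Require Import complex.
From mathcomp Require Import reals.
Set Implicit Arguments. Unset Strict Implicit. Unset Printing Implicit Defensive.
Import Order.TTheory GRing.Theory Num.Theory.
Local Open Scope ring_scope.

Definition mx_open (K : numDomainType) (m n : nat) (U : 'M[K]_(m, n) -> Prop) :=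
  forall A, U A -> exists2 e : K, 0 < e &
    forall B : 'M[K]_(m, n), (forall i j, `|B i j - A i j| < e) -> U B.

Definition mx_dense (K : numDomainType) (m n : nat) (U : 'M[K]_(m, n) -> Prop) :=
  forall (A : 'M[K]_(m, n)) (e : K), 0 < e ->
    exists B, U B /\ forall i j, `|B i j - A i j| < e.

(* A property P of N-dim subspaces W of K^M (W represented as the row space of a
   full-rank N x M matrix) holds generically on the Grassmannian Gr(N,M):
   there is an open dense subset of Gr(N,M), i.e. a set U of full-rank matrices
   saturated under "same row space", open and dense (Gr carries the quotient
   topology of the open dense set of full-rank matrices), on which P holds. *)
Definition generic_Gr (K : numFieldType) (N M : nat) (P : 'M[K]_(N, M) -> Prop) :=
  exists U : 'M[K]_(N, M) -> Prop,
    [/\ mx_open U, mx_dense U,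
        (forall A, U A -> row_free A),
        (forall A B, U A -> row_free B -> (A == B)%MS -> U B)
      & (forall A, U A -> P A)].

Definition phase_retrievable (R : realType) (N M : nat) (A : 'M[R[i]]_(N, M)) :=
  forall v w : 'rV[R[i]]_M, (v <= A)%MS -> (w <= A)%MS ->
    (forall k, `|v 0 k| = `|w 0 k|) ->
    exists l : R[i], `|l| = 1 /\ v = l *: w.

(* Main.v *)
Require Import Defs.
From mathcomp Require Import all_boot all_order all_algebra.
From mathcomp Require Import complex.
From mathcomp Require Import reals.
From mathcomp Require Import ring zify.
Import Order.TTheory GRing.Theory Num.Theory.
Local Open Scope ring_scope.
Set Implicit Arguments.
Unset Strict Implicit.
Unset Printing Implicit Defensive.

(* If phase retrieval fails for the row space of A, with columns a_k, then there
   are x, y and phases t_k with (y - t_k x) a_k = 0 and y - t_k x <> 0 for all k: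
   each a_k lies in a hyperplane taken from a family with few parameters. Such
   matrices A are covered by finitely many images of rational maps depending on
   4N - 3 + M (2N - 1) parameters, fewer than the 2NM real coordinates of A when
   4N - 3 < M. Hence the coordinates on each image satisfy a nontrivial polynomial
   relation, and the complement of the zero set of the product of these
   polynomials, saturated under GL_N, is the required open dense set. *)

(** * Polynomial functions in finitely many variables and algebraic dependence *)

Definition mpeval (K : fieldType) (I : finType) (n : nat)
    (c : {ffun {ffun I -> 'I_n.+1} -> K}) (p : I -> K) : K :=
  \sum_e c e * \prod_i p i ^+ e i.

(** Bounding each exponent separately, rather than the total degree, makes the exponent tuples a
    finite function type whose cardinality is a plain power. *)
Definition deg_le (K : fieldType) (I : finType) (n : nat) (f : (I -> K) -> K) :=
  exists c : {ffun {ffun I -> 'I_n.+1} -> K}, forall p, f p = mpeval c p.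

Section PolynomialFunctions.
Context (K : fieldType) (I : finType).
Implicit Types (f g : (I -> K) -> K) (n m : nat).

Lemma eq_deg_le n f g : (forall p, f p = g p) -> deg_le n f -> deg_le n g.
Proof. by move=> fg [c cE]; exists c => p; rewrite -fg cE. Qed.

Lemma deg_le_monomial n (e : I -> nat) :
  (forall i, e i <= n)%N -> deg_le n (fun p : I -> K => \prod_i p i ^+ e i).
Proof.
move=> len; pose e0 : {ffun I -> 'I_n.+1} := [ffun i => inord (e i)].
exists [ffun e' => (e' == e0)%:R] => p.
rewrite /mpeval (bigD1 e0) //= ffunE eqxx mul1r [X in _ + X]big1 ?addr0; last first.
  by move=> e' /negPf ne'; rewrite ffunE ne' mul0r.
by apply: eq_bigr => i _; rewrite ffunE inordK // ltnS.
Qed.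

Lemma deg_leZ n a f : deg_le n f -> deg_le n (fun p => a * f p).
Proof.
move=> [c cE]; exists [ffun e => a * c e] => p.
by rewrite cE /mpeval mulr_sumr; apply: eq_bigr => e _; rewrite ffunE mulrA.
Qed.

Lemma deg_le_sum n (J : finType) (F : J -> (I -> K) -> K) :
  (forall j, deg_le n (F j)) -> deg_le n (fun p => \sum_j F j p).
Proof.
move=> /fin_all_exists[c cE]; exists [ffun e => \sum_j c j e] => p.
rewrite /mpeval (eq_bigr _ (fun j _ => cE j p)) /mpeval exchange_big /=.
by apply: eq_bigr => e _; rewrite ffunE mulr_suml.
Qed.

Lemma deg_leM n m f g :
  deg_le n f -> deg_le m g -> deg_le (n + m) (fun p => f p * g p).
Proof.
move=> [c cE] [d dE].
apply: (@eq_deg_le _ (fun p => \sum_e \sum_e'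
  c e * (d e' * \prod_i p i ^+ (e i + e' i)))) => [p|].
  rewrite cE dE /mpeval mulr_suml; apply: eq_bigr => e _.
  rewrite mulr_sumr; apply: eq_bigr => e' _.
  under eq_bigr do rewrite exprD.
  by rewrite big_split /=; ring.
do 2! (apply: deg_le_sum => ?); do 2! apply: deg_leZ.
by apply: deg_le_monomial => i; rewrite leq_add // -ltnS.
Qed.

Lemma deg_le_leq n m f : (n <= m)%N -> deg_le n f -> deg_le m f.
Proof.
move=> le_nm [c cE]; apply: (@eq_deg_le _ (mpeval c)) => //.
apply: deg_le_sum => e; apply: deg_leZ; apply: deg_le_monomial => i.
by apply: leq_trans le_nm; rewrite -ltnS.
Qed.

Lemma deg_le1 : @deg_le K I 0 (fun=> 1).
Proof.
apply: (@eq_deg_le _ (fun p : I -> K => \prod_i p i ^+ 0)) => [p|].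
  by rewrite big1.
exact: deg_le_monomial.
Qed.

Lemma deg_leX n k f : deg_le n f -> deg_le (n * k) (fun p => f p ^+ k).
Proof.
move=> fn; elim: k => [|k IHk]; first by rewrite muln0; exact: deg_le1.
rewrite mulnS; apply: eq_deg_le (deg_leM fn IHk) => p.
by rewrite exprS.
Qed.

Lemma deg_le_prod n (J : finType) (F : J -> (I -> K) -> K) :
  (forall j, deg_le n (F j)) -> deg_le (#|J| * n) (fun p => \prod_j F j p).
Proof.
move=> Fn; rewrite cardT.
apply: (@eq_deg_le _ (fun p => \prod_(j <- enum J) F j p)) => [p|].
  by rewrite big_enum.
elim: (enum J) => [|j s IHs].
  by apply: eq_deg_le deg_le1 => p; rewrite big_nil.
by rewrite mulSn; apply: eq_deg_le (deg_leM (Fn j) IHs) => p; rewrite big_cons.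
Qed.

Definition polyfun f := exists n, deg_le n f.

Lemma polyfun_const a : polyfun (fun=> a).
Proof.
by exists 0%N; apply: eq_deg_le (deg_leZ a deg_le1) => p; rewrite mulr1.
Qed.

Lemma polyfun_var i : polyfun (fun p : I -> K => p i).
Proof.
exists 1%N; apply: eq_deg_le (@deg_le_monomial 1 (fun j => (j == i) : nat) _).
  move=> p; rewrite (bigD1 i) //= eqxx expr1 big1 ?mulr1 // => j /negPf->.
  by rewrite expr0.
by move=> j; case: eqP.
Qed.

Lemma polyfunM f g : polyfun f -> polyfun g -> polyfun (fun p => f p * g p).
Proof. by move=> [n fn] [m gm]; exists (n + m)%N; exact: deg_leM. Qed.

Lemma polyfun_sum (J : finType) (F : J -> (I -> K) -> K) :
  (forall j, polyfun (F j)) -> polyfun (fun p => \sum_j F j p).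
Proof.
move=> /fin_all_exists[n Fn]; exists (\max_j n j)%N.
by apply: deg_le_sum => j; apply: deg_le_leq (Fn j); exact: leq_bigmax.
Qed.

Lemma polyfunD f g : polyfun f -> polyfun g -> polyfun (fun p => f p + g p).
Proof.
move=> pf pg.
have [n h] : polyfun (fun p => \sum_b (if b then f p else g p)).
  by apply: polyfun_sum => -[].
by exists n; apply: eq_deg_le h => p; rewrite big_bool.
Qed.

Lemma polyfunN f : polyfun f -> polyfun (fun p => - f p).
Proof.
move=> pf; have [n h] := polyfunM (polyfun_const (- 1)) pf.
by exists n; apply: eq_deg_le h => p; rewrite mulN1r.
Qed.

End PolynomialFunctions.

(* The monomials of degree at most n in each of the #|D| coordinates, after
   clearing denominators, become polynomials of degree O(n) in #|I| < #|D|
   parameters, so for large n they outnumber the available monomials. *)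
Lemma rational_dependence (K : fieldType) (I D : finType)
    (f g : D -> (I -> K) -> K) :
  (#|I| < #|D|)%N -> (forall i, polyfun (f i)) -> (forall i, polyfun (g i)) ->
  exists n, exists2 c : {ffun {ffun D -> 'I_n.+1} -> K}, c != 0 &
    forall (p : I -> K) (z : D -> K), (forall i, g i p != 0) ->
      (forall i, f i p = z i * g i p) -> mpeval c z = 0.
Proof.
move=> ltID /fin_all_exists[bf fb] /fin_all_exists[bg gb].
pose b := (\max_i (maxn (bf i) (bg i)))%N.
have {}fb i : deg_le b (f i).
  apply: deg_le_leq (fb i); apply: leq_trans (leq_bigmax i).
  exact: leq_maxl.
have {}gb i : deg_le b (g i).
  apply: deg_le_leq (gb i); apply: leq_trans (leq_bigmax i).
  exact: leq_maxr.
(* With this [n], the bound [((#|D| * b + 1) * (n + 1)) ^ #|I|] equals [n * (n + 1) ^ #|I|], which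
   is below [(n + 1) ^ (#|I| + 1)]. *)
pose n := ((#|D| * b).+1 ^ #|I|)%N.
(* [F e] is the monomial [e] at the quotients [f i / g i], multiplied by the common denominator
   [\prod_i g i ^+ n]. *)
pose F (e : {ffun D -> 'I_n.+1}) p := \prod_i (f i p ^+ e i * g i p ^+ (n - e i)).
have Fb e : deg_le (#|D| * (b * n)) (F e).
  apply: deg_le_prod => i.
  have le_en : (e i <= n)%N by rewrite -ltnS.
  apply: (@deg_le_leq _ _ (b * e i + b * (n - e i))).
    by rewrite -mulnDr subnKC.
  by apply: deg_leM; exact: deg_leX.
have [L LE] := fin_all_exists Fb.
have cardlt : (#|{ffun I -> 'I_(#|D| * (b * n)).+1}| <
               #|{ffun D -> 'I_n.+1}|)%N.
  rewrite !card_ffun !card_ord.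
  apply: (@leq_trans (n.+1 ^ #|I|.+1)); last by rewrite leq_pexp2l.
  rewrite expnS; apply: (@leq_ltn_trans (((#|D| * b).+1 * n.+1) ^ #|I|)%N).
    by case: #|I| => [|k]; rewrite ?expn0 // leq_exp2r //; nia.
  by rewrite expnMn -/n ltn_pmul2r ?expn_gt0.
(* Row [e] lists the coefficients of [F e]. There are more rows than columns, so a nonzero left
   kernel vector gives a linear relation between the [F e]. *)
pose A := \matrix_(r < #|{ffun D -> 'I_n.+1}|,
    s < #|{ffun I -> 'I_(#|D| * (b * n)).+1}|) L (enum_val r) (enum_val s).
have : kermx A != 0.
  rewrite kermx_eq0 -row_leq_rank -ltnNge.
  exact: leq_ltn_trans (rank_leq_col A) cardlt.
case/rowV0Pn=> u /sub_kermxP uA0 un0.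
exists n, [ffun e => u 0 (enum_rank e)].
  apply: contraNneq un0 => c0; apply/eqP/rowP => r.
  by move/ffunP/(_ (enum_val r)): c0; rewrite !ffunE enum_valK mxE.
move=> p z gn0 fz.
have F0 : \sum_e u 0 (enum_rank e) * F e p = 0.
  under eq_bigr do rewrite LE /mpeval mulr_sumr.
  rewrite exchange_big big1 //= => m _.
  have := congr1 (fun B : 'rV_ _ => B 0 (enum_rank m)) uA0.
  rewrite !mxE => u0; under eq_bigr do rewrite mulrA.
  rewrite -mulr_suml [X in X * _](_ : _ = 0) ?mul0r // -[RHS]u0.
  rewrite (reindex (@enum_val {ffun D -> 'I_n.+1} predT)) /=; last first.
    by apply: onW_bij; exact: enum_val_bij.
  by apply: eq_bigr => r _; rewrite mxE enum_rankK enum_valK.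
have Gn0 : \prod_i g i p ^+ n != 0.
  by rewrite prodf_seq_neq0; apply/allP => i _; rewrite expf_neq0.
apply: (mulIf Gn0); rewrite mul0r -[RHS]F0 /mpeval mulr_suml.
apply: eq_bigr => e _; rewrite ffunE -mulrA; congr (_ * _).
rewrite -big_split; apply: eq_bigr => i _ /=.
have le_en : (e i <= n)%N by rewrite -ltnS.
by rewrite fz exprMn -mulrA -exprD subnKC.
Qed.

(** * Points where finitely many nonzero polynomials are all nonzero *)

(** Reduction modulo [B] isolates the lowest digit; induction handles the quotients. *)
Lemma digits_inj (B d : nat) (e e' : nat -> nat) :
  (forall i, (i < d)%N -> (e i < B)%N) -> (forall i, (i < d)%N -> (e' i < B)%N) ->
  (\sum_(i < d) e i * B ^ i = \sum_(i < d) e' i * B ^ i)%N ->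
  forall i, (i < d)%N -> e i = e' i.
Proof.
elim: d e e' => // d IHd e e' eB e'B.
have split_digits (h : nat -> nat) : (\sum_(i < d.+1) h i * B ^ i =
    (\sum_(i < d) h i.+1 * B ^ i) * B + h 0%N)%N.
  rewrite big_ord_recl muln1 addnC big_distrl; congr (_ + _)%N => /=.
  by apply: eq_bigr => i _; rewrite /bump add1n expnSr mulnA.
rewrite !split_digits => eq_sum.
have eq0 : e 0%N = e' 0%N.
  have /= := congr1 (modn^~ B) eq_sum.
  by rewrite !modnMDl !modn_small ?eB ?e'B.
move: eq_sum; rewrite eq0 => /addIn/eqP; rewrite eqn_pmul2r; last first.
  by apply: leq_trans (eB 0%N _).
move=> /eqP eq_sum [|i] // lt_id.
by apply: (IHd (e \o S) (e' \o S)) => // j; [exact: (eB j.+1)|exact: (e'B j.+1)].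
Qed.

Lemma exists_nonroot (K : numDomainType) (h : {poly K}) (u : nat -> K) :
  injective u -> h != 0 -> exists m, h.[u m] != 0.
Proof.
move=> u_inj hn0; pose s := map u (iota 0 (size h)).
have : ~~ all (root h) s.
  apply: contraL (leqnn (size h)) => hs; rewrite -ltnNge.
  rewrite -[X in (X < _)%N](size_iota 0) -(size_map u).
  by apply: max_poly_roots; rewrite // map_inj_uniq ?iota_uniq.
by case/allPn=> _ /mapP[m _ ->] hm; exists m.
Qed.

(* Kronecker substitution: writing exponents in a base exceeding all degrees,
   z_i := T^(B^i) sends distinct monomials to distinct powers of T, so each
   nonzero polynomial remains nonzero as a polynomial in T. *)
Lemma mpeval_prod_neq0 (K : numFieldType) (D S : finType) (n : S -> nat)
    (c : forall s, {ffun {ffun D -> 'I_(n s).+1} -> K}) :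
  (forall s, c s != 0) ->
  exists m : D -> nat, \prod_s mpeval (c s) (fun i => (m i)%:R) != 0.
Proof.
move=> cn0; pose B := (\max_s n s).+1.
pose w s (e : {ffun D -> 'I_(n s).+1}) := (\sum_i e i * B ^ enum_rank i)%N.
have w_inj s : injective (w s).
  (* Here [oapp] and [insub] extend the exponents by 0 to a digit sequence on all naturals, as
     [digits_inj] requires. *)
  have wE e : w s e = (\sum_(i < #|D|)
      oapp (fun j : 'I_#|D| => val (e (enum_val j))) 0%N (insub (val i)) * B ^ i)%N.
    rewrite /w (reindex (@enum_val D predT)) /=; last first.
      by apply: onW_bij; exact: enum_val_bij.
    by apply: eq_bigr => i _; rewrite enum_valK valK.
  move=> e e'; rewrite !wE => eq_w; apply/ffunP => i; apply: val_inj.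
  have ltB (h : {ffun D -> 'I_(n s).+1}) j : (j < #|D|)%N ->
      (oapp (fun k : 'I_#|D| => val (h (enum_val k))) 0 (insub j) < B)%N.
    move=> lt_jD; rewrite insubT /= ltnS.
    by rewrite (leq_trans _ (leq_bigmax s)) // -ltnS.
  have := digits_inj (ltB e) (ltB e') eq_w (ltn_ord (enum_rank i)).
  by rewrite valK /= enum_rankK.
pose h s := \sum_e c s e *: 'X^(w s e).
have hn0 s : h s != 0.
  apply: contraNneq (cn0 s) => h0; apply/eqP; apply/ffunP => e.
  rewrite ffunE -[RHS](coef0 _ (w s e)) -h0 coef_sum (bigD1 e) //=.
  rewrite coefZ coefXn eqxx mulr1 big1 ?addr0 // => e' /negPf ne.
  by rewrite coefZ coefXn (inj_eq (@w_inj s)) eq_sym ne mulr0.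
have [m hm] : exists m, (\prod_s h s).[m%:R] != 0.
  apply: (exists_nonroot (u := fun m => m%:R)).
    exact: mulrIn (oner_neq0 K).
  by apply/prodf_neq0 => s _.
exists (fun i => m ^ (B ^ enum_rank i))%N.
move: hm; rewrite horner_prod; congr (_ != 0); apply: eq_bigr => s _.
rewrite horner_sum; apply: eq_bigr => e _.
rewrite hornerZ hornerXn -natrX /w expn_sum natr_prod; congr (_ * _).
by apply: eq_bigr => i _; rewrite -natrX -expnM mulnC.
Qed.

(** Along the line from [a] to [b] the product is a one-variable polynomial, nonzero at [t = 1]; its
    finitely many roots miss some [d / (m + 1)]. *)
Lemma mpeval_line_neq0 (K : numFieldType) (D S : finType) (n : S -> nat)
    (c : forall s, {ffun {ffun D -> 'I_(n s).+1} -> K}) (a b : D -> K) (d : K) :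
  0 < d -> \prod_s mpeval (c s) b != 0 ->
  exists2 t, 0 < t <= d &
    \prod_s mpeval (c s) (fun i => a i + t * (b i - a i)) != 0.
Proof.
move=> d0 bn0.
pose h := \prod_s \sum_e c s e *: \prod_i ((a i)%:P + (b i - a i) *: 'X) ^+ e i.
have hE t : h.[t] = \prod_s mpeval (c s) (fun i => a i + t * (b i - a i)).
  rewrite horner_prod; apply: eq_bigr => s _.
  rewrite horner_sum; apply: eq_bigr => e _.
  rewrite hornerZ horner_prod; congr (_ * _); apply: eq_bigr => i _.
  by rewrite horner_exp hornerD hornerC hornerZ hornerX mulrC.
have hn0 : h != 0.
  apply: contraNneq bn0 => h0; have := hE 1; rewrite h0 horner0 => /esym/eqP.
  congr (_ == 0); apply: eq_bigr => s _; apply: eq_bigr => e _.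
  by congr (_ * _); apply: eq_bigr => i _; rewrite mul1r addrC subrK.
have [m hm] : exists m, h.[d / m.+1%:R] != 0.
  apply: (exists_nonroot (u := fun m => d / m.+1%:R)) hn0 => m m'.
  by move/(mulfI (lt0r_neq0 d0))/invr_inj/(mulrIn (oner_neq0 K)) => -[->].
exists (d / m.+1%:R); last by rewrite -hE.
by rewrite divr_gt0 ?ltr0n //= ler_pdivrMr ?ltr0n // ler_peMr ?ler1n // ltW.
Qed.

(** * Phase collisions and their parametrization *)

(** The real coordinates are kept as elements of [K], so that polynomials over [K] can be evaluated
    at them. *)
Definition re_im (K : numClosedFieldType) (N M : nat) (A : 'M[K]_(N, M))
    (d : bool * 'I_N * 'I_M) : K :=
  let: (b, i, k) := d in if b then 'Re (A i k) else 'Im (A i k).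

(* The equations |x a_k| = |y a_k| on the columns a_k of A, with the phases
   t_k exhibited. *)
Definition phase_collision (K : numClosedFieldType) (N M : nat)
    (A : 'M[K]_(N, M)) (x y : 'rV[K]_N) (t : 'I_M -> K) :=
  [/\ x != 0, forall k, `|t k| = 1, forall k, y - t k *: x != 0
    & forall k, (y - t k *: x) *m col k A = 0].

Section Collision.
Context (K : numClosedFieldType).

Lemma collision_mull N M (g : 'M[K]_N) (A : 'M_(N, M)) x y t :
  g \in unitmx -> phase_collision A x y t ->
  phase_collision (g *m A) (x *m invmx g) (y *m invmx g) t.
Proof.
move=> gU [xn0 t1 yn0 yA]; have gf : row_free (invmx g).
  by rewrite row_free_unit unitmx_inv.
have E k : y *m invmx g - t k *: (x *m invmx g) = (y - t k *: x) *m invmx g.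
  by rewrite mulmxBl scalemxAl.
split=> // [|k|k]; rewrite ?E ?mulmx_free_eq0 //.
by rewrite !colE -!mulmxA mulKmx // -colE.
Qed.

(** A nonzero [x] with [x *m A = 0] would give the collision of [x] and [2x] with all phases 1. *)
Lemma row_free_no_collision N M (A : 'M[K]_(N, M)) :
  (forall x y t, ~ phase_collision A x y t) -> row_free A.
Proof.
move=> noc; apply: inj_row_free => x xA0; apply/eqP/negP => /negP xn0.
apply: (noc x (x + x) (fun=> 1)); split=> // k; rewrite ?normr1 ?scale1r ?addrK //.
by rewrite colE mulmxA xA0 mul0mx.
Qed.

(** For [v = x *m A] and [w = y *m A], the quotients [w_k / v_k] serve as phases: either some
    [y - t_k x] vanishes and [v], [w] are proportional, or there is a collision. *)
Lemma retrieval_no_collision N M (A : 'M[K]_(N, M)) (v w : 'rV_M) :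
  (forall x y t, ~ phase_collision A x y t) -> (v <= A)%MS -> (w <= A)%MS ->
  (forall k, `|v 0 k| = `|w 0 k|) -> exists l : K, `|l| = 1 /\ v = l *: w.
Proof.
move=> noc /submxP[x vE] /submxP[y wE] vw.
have [x0|xn0] := eqVneq x 0.
  exists 1; rewrite normr1 scale1r; split=> //; apply/rowP => k.
  have v0 : v = 0 by rewrite vE x0 mul0mx.
  by apply/esym/eqP; rewrite v0 mxE -normr_eq0 -vw v0 mxE normr0.
(* Where [v_k = 0] also [w_k = 0], so any phase fits. *)
pose t k := if v 0 k == 0 then 1 else w 0 k / v 0 k.
have t1 k : `|t k| = 1.
  rewrite /t; case: eqP => [|/eqP vn0]; first by rewrite normr1.
  by rewrite normf_div vw divff // -vw normr_eq0.
have [/existsP[k /eqP yt]|] := boolP [exists k, y - t k *: x == 0].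
  have tn0 : t k != 0 by rewrite -normr_eq0 t1 oner_eq0.
  exists (t k)^-1; rewrite normfV t1 invr1; split=> //.
  move/eqP: yt; rewrite subr_eq0 => /eqP yt.
  by rewrite wE yt -scalemxAl -vE scalerA mulVf // scale1r.
rewrite negb_exists => /forallP ytn0; exfalso; apply: (noc x y t); split=> // k.
rewrite colE mulmxA mulmxBl -scalemxAl -vE -wE -colE; apply/colP => i.
rewrite !mxE ord1 /t; case: eqP => [v0|/eqP vn0]; last by rewrite divfK ?subrr.
by rewrite v0 mulr0 subr0; apply/eqP; rewrite -normr_eq0 -vw v0 normr0.
Qed.

(* Rescaling x, y and t uses up three real parameters. *)
Lemma collision_normalize N M (A : 'M[K]_(N, M)) x y t :
  phase_collision A x y t -> exists j x' y' t',
    [/\ phase_collision A x' y' t', x' 0 j = 1 & y' 0 j \is Num.real].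
Proof.
move=> [xn0 t1 yn0 yA].
have [j xj] : exists j, x 0 j != 0.
  by apply/existsP; move: xn0; apply: contraNT => /existsPn h;
     apply/eqP/rowP => j; rewrite mxE; apply/eqP/negPn/h.
(* The phase [s] rotates [r] onto the nonnegative real axis. *)
pose r := y 0 j / x 0 j; pose s := if r == 0 then 1 else `|r| / r.
have s1 : `|s| = 1.
  rewrite /s; case: eqP => [|/eqP rn0]; first by rewrite normr1.
  by rewrite normf_div normr_id divff ?normr_eq0.
have sn0 : s != 0 by rewrite -normr_eq0 s1 oner_eq0.
exists j, ((x 0 j)^-1 *: x), ((s / x 0 j) *: y), (fun k => s * t k).
have E k : (s / x 0 j) *: y - (s * t k) *: ((x 0 j)^-1 *: x) =
    (s / x 0 j) *: (y - t k *: x).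
  by rewrite scalerBr !scalerA mulrAC.
split; last 2 first.
- by rewrite mxE mulVf.
- rewrite mxE -mulrA [_^-1 * _]mulrC -/r /s; case: eqP => [->|/eqP rn0].
    by rewrite mulr0.
  by rewrite divfK // normr_real.
split=> [|k|k|k].
- by rewrite scaler_eq0 invr_eq0 negb_or xj.
- by rewrite normrM s1 t1 mulr1.
- by rewrite E scaler_eq0 negb_or yn0 mulf_neq0 ?invr_eq0.
- by rewrite E -scalemxAl yA scaler0.
Qed.

(* On the stratum where y_(J k) - t_k x_(J k) is nonzero for each k, the J k-th
   entry of the column a_k is determined by the others. Separating variables
   from their conjugates, all real and imaginary parts of A are rational
   functions of x, y (minus 3 normalized coordinates), t and the free entries:
   4N - 3 + M (2N - 1) < 2 N M parameters. *)
Lemma stratum_dependence N M (j : 'I_N) (J : 'I_M -> 'I_N) :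
  (4 * N - 2 <= M)%N ->
  exists n, exists2 c : {ffun {ffun bool * 'I_N * 'I_M -> 'I_n.+1} -> K},
    c != 0 & forall A x y t, phase_collision A x y t ->
      x 0 j = 1 -> y 0 j \is Num.real ->
      (forall k, y 0 (J k) - t k * x 0 (J k) != 0) -> mpeval c (re_im A) = 0.
Proof.
case: N j J => [[]//|N] j J leM.
(* [None] stands for the real number [y_j]; then come the other coordinates of [x] and [y] with
   their conjugates, the phases, and the free real coordinates of [A]. *)
pose I : finType :=
  option (bool * bool * 'I_N + 'I_M + bool * 'I_N * 'I_M).
pose xv b i (p : I -> K) :=
  if unlift j i is Some i' then p (Some (inl (inl (true, b, i')))) else 1.
pose yv b i (p : I -> K) :=
  if unlift j i is Some i' then p (Some (inl (inl (false, b, i')))) else p None.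
pose tv k (p : I -> K) := p (Some (inl (inr k))).
pose av b i k (p : I -> K) := p (Some (inr (b, i, k))).
(* [al] is [y_i - t_k x_i], and [be] is [t_k] times its conjugate: since [|t_k| = 1], this factor
   removes the conjugate of [t_k]. *)
pose al k i p := yv true i p + - (tv k p * xv true i p).
pose be k i p := tv k p * yv false i p + - xv false i p.
pose S k p := \sum_i al k (lift (J k) i) p * (av true i k p + 'i * av false i k p).
pose T k p := \sum_i
  be k (lift (J k) i) p * (av true i k p + - ('i * av false i k p)).
(* For [a] the [J k]-th entry of the column, [al * a + S = 0] and [be * a^* + T = 0]; solving for
   [a] and [a^*] gives its real and imaginary parts over [2 * al * be]. *)
pose num (d : bool * 'I_N.+1 * 'I_M) p := let: (b, i, k) := d in
  if unlift (J k) i is Some i' then av b i' k p else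
  if b then - (S k p * be k (J k) p + T k p * al k (J k) p)
  else 'i * (S k p * be k (J k) p + - (T k p * al k (J k) p)).
pose den (d : bool * 'I_N.+1 * 'I_M) p := let: (b, i, k) := d in
  if unlift (J k) i is Some i' then 1 else 2 * (al k (J k) p * be k (J k) p).
have pav b i k : polyfun (av b i k) by exact: polyfun_var.
have ptv k : polyfun (tv k) by exact: polyfun_var.
have pxv b i : polyfun (xv b i).
  by rewrite /xv; case: (unlift j i) => [i'|];
    [exact: polyfun_var|exact: polyfun_const].
have pyv b i : polyfun (yv b i).
  by rewrite /yv; case: (unlift j i) => [i'|]; exact: polyfun_var.
have pal k i : polyfun (al k i).
  by apply: polyfunD => //; apply: polyfunN; exact: polyfunM.
have pbe k i : polyfun (be k i).
  by apply: polyfunD; [exact: polyfunM|exact: polyfunN].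
have pS k : polyfun (S k).
  apply: polyfun_sum => i; apply: polyfunM => //; apply: polyfunD => //.
  by apply: polyfunM => //; exact: polyfun_const.
have pT k : polyfun (T k).
  apply: polyfun_sum => i; apply: polyfunM => //; apply: polyfunD => //.
  by apply: polyfunN; apply: polyfunM => //; exact: polyfun_const.
have pnum d : polyfun (num d).
  case: d => -[b i] k; rewrite /num; case: (unlift (J k) i) => [i'|] //.
  case: b; first by apply: polyfunN; apply: polyfunD; exact: polyfunM.
  apply: polyfunM; first exact: polyfun_const.
  by apply: polyfunD; [|apply: polyfunN]; exact: polyfunM.
have pden d : polyfun (den d).
  case: d => -[b i] k; rewrite /den; case: (unlift (J k) i) => [i'|].
    exact: polyfun_const.
  by apply: polyfunM; [exact: polyfun_const|exact: polyfunM].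
(* The count reduces to [4N - 3 < M], with [N.+1] in the role of [N]. *)
have cardI : (#|I| < #|{: bool * 'I_N.+1 * 'I_M}|)%N.
  rewrite card_option !card_sum !card_prod !card_bool !card_ord.
  move: leM; nia.
have [n [c cn0 cE]] := rational_dependence cardI pnum pden.
exists n, c => // A x y t [_ t1 _ yA] xj yj yJ.
pose p (d : I) : K := match d with
  | None => y 0 j
  | Some (inl (inl (b, b', i))) =>
      let z := (if b then x else y) 0 (lift j i) in if b' then z else z^*
  | Some (inl (inr k)) => t k
  | Some (inr (b, i, k)) => re_im A (b, lift (J k) i, k)
  end.
have xE i : xv true i p = x 0 i.
  by rewrite /xv; case: unliftP => [i' ->|->].
have xcE i : xv false i p = (x 0 i)^*.
  by rewrite /xv; case: unliftP => [i' ->|->]; rewrite ?xj ?rmorph1.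
have yE i : yv true i p = y 0 i.
  by rewrite /yv; case: unliftP => [i' ->|->].
have ycE i : yv false i p = (y 0 i)^*.
  by rewrite /yv; case: unliftP => [i' ->|->]; rewrite //= conj_Creal.
have alE k i : al k i p = y 0 i - t k * x 0 i by rewrite /al xE yE.
have tn0 k : t k != 0 by rewrite -normr_eq0 t1 oner_eq0.
have beE k i : be k i p = t k * (al k i p)^*.
  rewrite /be xcE ycE alE rmorphB rmorphM mulrBr mulrA -normCK t1.
  by rewrite expr1n mul1r.
have avE b i k : av b i k p = re_im A (b, lift (J k) i, k) by [].
have SE k : al k (J k) p * A (J k) k + S k p = 0.
  have /rowP/(_ 0) := yA k; rewrite !mxE (bigD1_ord (J k)) //= !mxE.
  rewrite -alE => E; rewrite -[RHS]E; congr (_ + _); apply: eq_bigr => i _.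
  by rewrite !mxE -alE !avE /= -Crect.
have TE k : be k (J k) p * (A (J k) k)^* + T k p = 0.
  rewrite -[RHS](mulr0 (t k)) -[in RHS](rmorph0 Num.conj) -(SE k).
  rewrite rmorphD mulrDr rmorphM mulrA -beE; congr (_ + _).
  rewrite /T /S rmorph_sum mulr_sumr; apply: eq_bigr => i _.
  rewrite beE (rmorphM Num.conj) mulrA; congr (_ * _); rewrite !avE /=.
  by rewrite conjC_rect ?Creal_Re ?Creal_Im.
apply: (cE p) => -[[b i] k]; rewrite /num /den.
  case: unliftP => [i' _|_]; first exact: oner_neq0.
  by rewrite beE alE !mulf_neq0 ?pnatr_eq0 ?conjC_eq0.
case: unliftP => [i' ->|->]; first by rewrite mulr1.
have {}SE : S k p = - (al k (J k) p * A (J k) k).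
  by apply/eqP; rewrite -addr_eq0 addrC SE.
have {}TE : T k p = - (be k (J k) p * (A (J k) k)^*).
  by apply/eqP; rewrite -addr_eq0 addrC TE.
by rewrite SE TE /re_im; case: b; rewrite ?ReE ?ImE; field.
Qed.

End Collision.

(** * Continuity of functions of the matrix entries *)

Definition mx_continuous (K : numDomainType) (m n : nat) (f : 'M[K]_(m, n) -> K) :=
  forall (A : 'M[K]_(m, n)) (e : K), 0 < e -> exists2 d : K, 0 < d &
    forall B : 'M[K]_(m, n), (forall i j, `|B i j - A i j| < d) -> `|f B - f A| < e.

Section Continuity.
Context (K : numClosedFieldType) (m n : nat).
Implicit Types (f g : 'M[K]_(m, n) -> K).

Lemma eq_mx_continuous f g :
  (forall A, f A = g A) -> mx_continuous f -> mx_continuous g.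
Proof.
by move=> fg fc A e /(fc A)[d d0 h]; exists d => // B; rewrite -!fg; exact: h.
Qed.

Lemma mx_continuous_const a : @mx_continuous K m n (fun=> a).
Proof. by move=> A e e0; exists 1 => // B _; rewrite subrr normr0. Qed.

Lemma mx_continuous_coef i j : @mx_continuous K m n (fun A => A i j).
Proof. by move=> A e e0; exists e. Qed.

(** The order of [K] is partial, but positive elements are real, hence comparable. *)
Lemma exists_min (a b : K) : 0 < a -> 0 < b -> exists d, [/\ 0 < d, d <= a & d <= b].
Proof.
move=> a0 b0; have [ab|/ltW ba] := real_leP (gtr0_real a0) (gtr0_real b0).
  by exists a.
by exists b.
Qed.

Lemma mx_continuous_pair f g (A : 'M_(m, n)) (e : K) :
  mx_continuous f -> mx_continuous g -> 0 < e ->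
  exists2 d : K, 0 < d & forall B : 'M_(m, n), (forall i j, `|B i j - A i j| < d) ->
    `|f B - f A| < e /\ `|g B - g A| < e.
Proof.
move=> fc gc e0; have [d1 d10 h1] := fc A e e0; have [d2 d20 h2] := gc A e e0.
have [d [d0 dd1 dd2]] := exists_min d10 d20; exists d => // B BA.
by split; [apply: h1|apply: h2] => i j; exact: lt_le_trans (BA i j) _.
Qed.

Lemma mx_continuousD f g :
  mx_continuous f -> mx_continuous g -> mx_continuous (fun A => f A + g A).
Proof.
move=> fc gc A e e0.
have [d d0 h] := mx_continuous_pair A fc gc (divr_gt0 e0 (ltr0n _ 2)).
exists d => // B /h[h1 h2]; rewrite opprD addrACA [e]splitr.
exact: le_lt_trans (ler_normD _ _) (ltrD h1 h2).
Qed.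

Lemma mx_continuousM f g :
  mx_continuous f -> mx_continuous g -> mx_continuous (fun A => f A * g A).
Proof.
move=> fc gc A e e0; pose c := `|f A| + `|g A| + 1.
have c0 : 0 < c by rewrite ltr_wpDl // addr_ge0.
(* [e1 <= 1] absorbs the quadratic term of the expansion, and [e1 <= e / c] bounds the total. *)
have [e1 [e10 e11 e1c]] := exists_min ltr01 (divr_gt0 e0 c0).
have [d d0 h] := mx_continuous_pair A fc gc e10.
exists d => // B /h[h1 h2].
have -> : f B * g B - f A * g A =
    (f B - f A) * (g B - g A) + (f B - f A) * g A + f A * (g B - g A) by ring.
apply: (@lt_le_trans _ _ (e1 * c)); last by rewrite -ler_pdivlMr.
have -> : e1 * c = e1 + e1 * `|g A| + `|f A| * e1 by rewrite /c; ring.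
apply: le_lt_trans (ler_normD _ _) _; rewrite normrM.
apply: ltr_leD; last by rewrite ler_wpM2l // ltW.
apply: le_lt_trans (ler_normD _ _) _; rewrite !normrM.
apply: ltr_leD; last by rewrite ler_wpM2r // ltW.
by rewrite -[ltRHS]mulr1 ltr_pM // (lt_le_trans h2).
Qed.

Lemma mx_continuousX f k : mx_continuous f -> mx_continuous (fun A => f A ^+ k).
Proof.
move=> fc; elim: k => [|k IHk]; first exact: mx_continuous_const.
by apply: eq_mx_continuous (mx_continuousM fc IHk) => A; rewrite exprS.
Qed.

Lemma mx_continuous_sum (J : Type) (r : seq J) (F : J -> 'M[K]_(m, n) -> K) :
  (forall j, mx_continuous (F j)) -> mx_continuous (fun A => \sum_(j <- r) F j A).
Proof.
move=> Fc; elim: r => [|j r IHr].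
  by apply: eq_mx_continuous (mx_continuous_const 0) => A; rewrite big_nil.
by apply: eq_mx_continuous (mx_continuousD (Fc j) IHr) => A; rewrite big_cons.
Qed.

Lemma mx_continuous_prod (J : Type) (r : seq J) (F : J -> 'M[K]_(m, n) -> K) :
  (forall j, mx_continuous (F j)) -> mx_continuous (fun A => \prod_(j <- r) F j A).
Proof.
move=> Fc; elim: r => [|j r IHr].
  by apply: eq_mx_continuous (mx_continuous_const 1) => A; rewrite big_nil.
by apply: eq_mx_continuous (mx_continuousM (Fc j) IHr) => A; rewrite big_cons.
Qed.

Lemma mx_continuous_conj f : mx_continuous f -> mx_continuous (fun A => (f A)^*).
Proof.
move=> fc A e /(fc A)[d d0 h]; exists d => // B /h.
by rewrite -(rmorphB Num.conj) norm_conjC.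
Qed.

Lemma mx_continuous_re_im N (g : 'M[K]_(N, m)) d :
  mx_continuous (fun A : 'M[K]_(m, n) => re_im (g *m A) d).
Proof.
case: d => -[b i] k; rewrite /re_im.
have gc : mx_continuous (fun A : 'M[K]_(m, n) => (g *m A) i k).
  apply: (@eq_mx_continuous (fun A => \sum_j g i j * A j k)) => [A|].
    by rewrite mxE.
  apply: mx_continuous_sum => j; apply: mx_continuousM.
    exact: mx_continuous_const.
  exact: mx_continuous_coef.
have gcc := mx_continuous_conj gc; case: b.
  apply: eq_mx_continuous (mx_continuousM (mx_continuousD gc gcc)
    (mx_continuous_const 2^-1)) => A.
  by rewrite ReE.
apply: eq_mx_continuous (mx_continuousM (mx_continuousD gcc
  (mx_continuousM (mx_continuous_const (- 1)) gc))
  (mx_continuous_const ('i / 2))) => A.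
by rewrite ImE mulN1r mulrA [_ * 'i]mulrC.
Qed.

Lemma mx_open_neq0 f : mx_continuous f -> mx_open (fun A => f A != 0).
Proof.
move=> fc A fA; have [|d d0 h] := fc A `|f A|; first by rewrite normr_gt0.
exists d => // B /h; apply: contraTneq => ->.
by rewrite sub0r normrN ltxx.
Qed.

End Continuity.

(** * The open dense set of subspaces *)

Theorem theorem3p1 (R : realType) (N M : nat) :
  (4 * N - 2 <= M)%N -> generic_Gr (@phase_retrievable R N M).
Proof.
set K : numClosedFieldType := R[i]; move=> leM.
(* A stratum is a pair of a normalized coordinate [j] and a choice, for each [k], of a nonzero entry
   of [y - t_k x]. *)
have /fin_all_exists[n] : forall s : 'I_N * {ffun 'I_M -> 'I_N},
    exists n, exists c : {ffun {ffun bool * 'I_N * 'I_M -> 'I_n.+1} -> K},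
    c != 0 /\ forall A x y t, phase_collision A x y t ->
      x 0 s.1 = 1 -> y 0 s.1 \is Num.real ->
      (forall k, y 0 (s.2 k) - t k * x 0 (s.2 k) != 0) -> mpeval c (re_im A) = 0.
  by move=> [j J]; have [n [c c0 h]] := stratum_dependence K j J leM; exists n, c.
case/fin_all_exists=> c /all_and2[cn0 c0].
pose P (A : 'M[K]_(N, M)) := \prod_s mpeval (c s) (re_im A).
have no_collision A g : g \in unitmx -> P (g *m A) != 0 ->
    forall x y t, ~ phase_collision A x y t.
  move=> gU /prodf_neq0 Pn0 x y t /(collision_mull gU).
  case/collision_normalize=> j [x' [y' [t' [col xj yj]]]].
  have /fin_all_exists[J yJ] k : exists i, y' 0 i - t' k * x' 0 i != 0.
    case: col => _ _ /(_ k) yn0 _; apply/existsP; move: yn0.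
    apply: contraNT => /existsPn h; apply/eqP/rowP => i.
    by rewrite !mxE; apply/eqP/negPn/h.
  have /negP := Pn0 (j, finfun J) isT; apply; apply/eqP.
  by apply: (c0 (j, finfun J) _ _ _ _ col) => // k; rewrite ffunE.
(* Allowing every change of basis [g] saturates the nonvanishing set of [P]. *)
exists (fun A => exists2 g, g \in unitmx & P (g *m A) != 0); split.
- move=> A [g gU PA].
  have Pc : mx_continuous (fun A => P (g *m A)).
    apply: mx_continuous_prod => s; apply: mx_continuous_sum => e.
    apply: mx_continuousM; first exact: mx_continuous_const.
    apply: mx_continuous_prod => d; apply: mx_continuousX.
    exact: mx_continuous_re_im.
  have [e e0 h] := mx_open_neq0 Pc PA.
  by exists e => // B /h PB; exists g.
(* Density: [C] has coordinates [q], where [P] is nonzero, so points near [A] on the segment towards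
   [C] lie in the set. *)
- move=> A e e0; have [q qn0] := mpeval_prod_neq0 cn0.
  pose C := \matrix_(i < N, k < M)
    ((q (true, i, k))%:R + 'i * (q (false, i, k))%:R : K).
  have CE d : re_im C d = (q d)%:R.
    by case: d => -[[] i] k; rewrite /re_im mxE ?Re_rect ?Im_rect ?realn.
  (* The added 1 makes [r] positive and strictly larger than each [|C i k - A i k|]. *)
  pose r := \sum_i \sum_k `|C i k - A i k| + 1.
  have r0 : 0 < r.
    by rewrite ltr_wpDl //; do 2! apply: sumr_ge0 => ? _.
  have [t /andP[t0 td] tn0] :=
    mpeval_line_neq0 (re_im A) (divr_gt0 e0 r0) qn0.
  exists (A + t *: (C - A)); split.
    exists 1%:M; rewrite ?unitmx1 // mul1mx; move: tn0.
    congr (_ != 0); apply: eq_bigr => s _; apply: eq_bigr => d _.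
    congr (_ * _); apply: eq_bigr => -[[b i] k] _; congr (_ ^+ _).
    rewrite -CE /re_im !mxE; case: b.
      by rewrite [RHS]raddfD /= ReMl ?gtr0_real // [in RHS]raddfB.
    by rewrite [RHS]raddfD /= ImMl ?gtr0_real // [in RHS]raddfB.
  move=> i k; have -> : (A + t *: (C - A)) i k - A i k = t * (C i k - A i k).
    by rewrite !mxE; ring.
  rewrite normrM gtr0_norm //.
  apply: (@lt_le_trans _ _ (t * r)); last by rewrite -ler_pdivlMr.
  rewrite ltr_pM2l // /r ltr_pwDr //.
  rewrite (bigD1 i) //= (bigD1 k) //= -addrA lerDl addr_ge0 //.
    by apply: sumr_ge0.
  by do 2! apply: sumr_ge0 => ? _.
- by move=> A [g gU /(no_collision _ _ gU)]; exact: row_free_no_collision.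
(* [B = h *m A] with [h] invertible by full rank of [B], and [g *m invmx h] brings [B] to
   [g *m A]. *)
- move=> A B [g gU PA] fB /andP[_ /submxP[h BE]].
  have hU : h \in unitmx.
    rewrite -row_free_unit -row_leq_rank.
    by move: fB; rewrite -row_leq_rank BE => /leq_trans; apply; exact: mxrankM_maxl.
  exists (g *m invmx h); first by rewrite unitmx_mul gU unitmx_inv.
  by rewrite BE -mulmxA mulKmx.
- move=> A [g gU /(no_collision _ _ gU) noc] v w vA wA vw.
  exact: retrieval_no_collision noc vA wA vw.
Qed.
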